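(* Let $\vec t=(t_1,t_2,\dots)$ be a sequence with $t_j\in[-1,1]$ for all $j\ge 1$, let $k\ge 1$ be an integer, and let $i_1,\dots,i_k$ be positive integers with $i_1>1$. Let $\mathcal P(k)$ be the set of ordered partitions (compositions) $\mathbf p=(p_1,\dots,p_r)$ of $k$ (all lengths $r\ge 1$, $p_j\ge 1$, $p_1+\dots+p_r=k$), and put $P_0=0$, $P_j=\sum_{\ell=1}^{j}p_\ell$. Then $$\zeta^{\vec t}(i_1,\dots,i_k)=\sum_{\mathbf p=(p_1,\dots,p_r)\in\mathcal P(k)}\zeta\Big(\big(\vec t^{\,p_1-1},\sum_{j=1}^{P_1}i_{j}\big),\big(\vec t^{\,p_2-1},\sum_{j=P_1+1}^{P_2}i_{j}\big),\dots,\big(\vec t^{\,p_r-1},\sum_{j=P_{r-1}+1}^{P_r}i_{j}\big)\Big).$$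
   Context: For positive integers $i_1,\dots,i_k$ with $i_1\ge 2$ and a sequence $\vec t=(t_1,t_2,\dots)$ with $t_j\in[-1,1]$, the multi-interpolated multiple zeta value is $$\zeta^{\vec t}(i_1,\dots,i_k)=\sum_{\ell_1\ge\cdots\ge\ell_k\ge 1}\frac{\prod_{j=1}^\infty t_j^{\sigma_j(\ell_1,\dots,\ell_k)}}{\ell_1^{i_1}\cdots\ell_k^{i_k}},\qquad \sigma_j(\ell_1,\dots,\ell_k)=|\{1\le r\le k-1:\ \ell_r=\ell_{r+1}=j\}|,$$ with the convention $t_j^0=1$ (also when $t_j=0$). For integers $j_1,\dots,j_k\ge 0$, multiple zeta values with variables $\vec t$ are defined by $$\zeta\big((\vec t^{\,j_1},i_1),\dots,(\vec t^{\,j_k},i_k)\big)=\sum_{\ell_1>\cdots>\ell_k\ge 1}\frac{t_{\ell_1}^{j_1}\cdots t_{\ell_k}^{j_k}}{\ell_1^{i_1}\cdots\ell_k^{i_k}}.$$ *)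

(* Defs.v *)
From mathcomp Require Import all_boot all_order all_algebra.
From mathcomp Require Import all_classical all_reals.
From mathcomp Require Import ereal numfun esum.

Set Implicit Arguments.
Unset Strict Implicit.
Unset Printing Implicit Defensive.

Import Order.TTheory GRing.Theory Num.Theory.

Local Open Scope classical_set_scope.
Local Open Scope ring_scope.

(* Unordered sum of a real family indexed by D. [esum] only makes sense for
   nonnegative families, so a signed family is summed as the sum of its
   positive parts minus the sum of its negative parts; this is the usual value
   whenever the family is absolutely summable ([summable D (EFin \o f)]). *)
Definition rsum (R : realType) (T : choiceType) (D : set T) (f : T -> R) : R :=
  fine (\esum_(x in D) (EFin \o f)^\+ x - \esum_(x in D) (EFin \o f)^\- x)%E.

(* Tuples (l_1, ..., l_k) are sequences of size k with entry l_r at position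
   r - 1. The sequence t is read as (t 1, t 2, ...); the value t 0 is never
   used. *)

Definition noninc_indices (k : nat) : set (seq nat) :=
  [set l | [/\ size l = k, sorted geq l & all (fun x => 0 < x)%N l]].

Definition dec_indices (k : nat) : set (seq nat) :=
  [set l | [/\ size l = k, sorted gtn l & all (fun x => 0 < x)%N l]].

Definition sigma (j : nat) (l : seq nat) : nat :=
  #|[pred r : 'I_(size l).-1 | (nth 0%N l r == j) && (nth 0%N l r.+1 == j)]|.

(* The product over all j >= 1 is a finitely supported one: sigma j l = 0 for
   all but finitely many j, and x ^+ 0 = 1 for every x, including x = 0. *)
Definition interpolated_mzv (R : realType) (t : nat -> R) (i : seq nat) : R :=
  rsum (noninc_indices (size i)) (fun l =>
    (\big[*%R/1]_(j \in [set j : nat | (1 <= j)%N]) t j ^+ sigma j l)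
    / \prod_(r < size i) (nth 0%N l r)%:R ^+ nth 0%N i r).

(* The argument ((t^{j_1}, i_1), ..., (t^{j_k}, i_k)) is encoded as the
   sequence of pairs [:: (j_1, i_1); ...; (j_k, i_k)]. *)
Definition mzv_var (R : realType) (t : nat -> R) (a : seq (nat * nat)) : R :=
  rsum (dec_indices (size a)) (fun l =>
    (\prod_(r < size a) t (nth 0%N l r) ^+ (nth (0%N, 0%N) a r).1)
    / \prod_(r < size a) (nth 0%N l r)%:R ^+ (nth (0%N, 0%N) a r).2).

Definition compositions (k : nat) : set (seq nat) :=
  [set p | all (fun x => 0 < x)%N p /\ sumn p = k].

Definition psum (p : seq nat) (s : nat) : nat := sumn (take s p).

(* Position s < size p carries the pair
   (p_{s+1} - 1, i_{P_s + 1} + ... + i_{P_{s+1}}), where P_s = psum p s; the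
   bounds below are P_s <= j < P_{s+1} because i_{j+1} is [nth 0 i j]. *)
Definition merged (i p : seq nat) : seq (nat * nat) :=
  mkseq (fun s => ((nth 0%N p s).-1,
                   (\sum_(psum p s <= j < psum p s.+1) nth 0 i j)%N))
        (size p).

(* Main.v *)
(* A nonincreasing tuple l is determined by its distinct values
   m_1 > ... > m_r and their multiplicities p_1, ..., p_r, which form a
   composition of k; in l, sigma_j is the multiplicity of j minus 1, so the
   summand of l is that of (m, p) on the right-hand side. Splitting the sum
   along this bijection requires absolute convergence, i.e. that
   T_k(1) is finite, where
     T_k(n) = sum_(l_1 >= ... >= l_k >= n) 1 / (l_1^2 l_2 ... l_k).
   Summing over l_k last gives T_k(n) = sum_(x >= n) T_(k-1)(x) / x, hence
   T_k(n) <= 2^k / n by induction, since sum_(x >= n) 1 / x^2 <= 2 / n. *)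
Require Import Defs.
From mathcomp Require Import all_boot all_order all_algebra.
From mathcomp Require Import all_classical all_reals.
From mathcomp Require Import ereal normedtype sequences numfun esum.
From mathcomp Require Import finmap ring lra.

Set Implicit Arguments.
Unset Strict Implicit.
Unset Printing Implicit Defensive.

Import Order.TTheory GRing.Theory Num.Theory.

Local Open Scope classical_set_scope.
Local Open Scope ring_scope.

Lemma geq_trans : transitive geq.
Proof. by move=> a b c /= ba cb; exact: leq_trans cb ba. Qed.

Lemma anti_geq : antisymmetric geq.
Proof. by move=> x y xy; apply: anti_leq; rewrite andbC. Qed.

(** * Splitting unordered sums along a bijection *)

Lemma eq_rsum (R : realType) (T : choiceType) (D : set T) (f g : T -> R) :
  (forall x, D x -> f x = g x) -> rsum D f = rsum D g.
Proof.
move=> fg; congr (fine (_ - _)%E); apply: eq_esum => x Dx.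
  by rewrite !funeposE /= fg.
by rewrite !funenegE /= fg.
Qed.

(** Tonelli for a nonnegative family: once D is reindexed by dependent pairs the sum is iterated,
    and the outer sum has finitely many terms because K is finite. *)
Lemma esum_sigma (R : realType) (I J T : choiceType) (K : set I)
    (L : I -> set J) (D : set T) (e : I * J -> T) (h : T -> \bar R) :
  finite_set K -> set_bij (K `*`` L) D e -> (forall x, (0 <= h x)%E) ->
  (\esum_(x in D) h x = \sum_(i <- fset_set K) \esum_(j in L i) h (e (i, j)))%E.
Proof.
move=> finK bije h0; rewrite (reindex_esum (K `*`` L) D e)//.
rewrite (eq_esum (b := fun u => h (e (u.1, u.2)))); last by case.
rewrite -(esum_esum (a := fun i j => h (e (i, j))))//.
rewrite esum_fset// ?fsbig_finite// => i _; exact: esum_ge0.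
Qed.

(** The nonnegative case applies to the positive and to the negative part; summability makes both
    totals finite, so their difference can be taken term by term in K. *)
Lemma rsum_sigma (R : realType) (I J T : choiceType) (K : set I)
    (L : I -> set J) (D : set T) (e : I * J -> T) (f : T -> R) :
  finite_set K -> set_bij (K `*`` L) D e -> summable D (EFin \o f) ->
  rsum D f = \sum_(i \in K) rsum (L i) (fun j => f (e (i, j))).
Proof.
move=> finK bije sumf; rewrite fsbig_finite//= /rsum.
(* A finite sum of extended reals is finite only if each term is, so every inner sum is finite and
   [fine] commutes with the sums and differences below. *)
have fin (h : T -> \bar R) : (forall x, (0 <= h x)%E) -> summable D h ->
    forall i, i \in fset_set K -> (\esum_(j in L i) h (e (i, j)))%E \is a fin_num.
  move=> h0; rewrite summableE (eq_esum (b := h)) => [|x _]; last first.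
    by rewrite gee0_abs.
  by rewrite (esum_sigma finK bije h0) => /sum_fin_numP + i iK; exact.
have finp := fin _ (funepos_ge0 (EFin \o f)) (summable_funepos sumf).
have finn := fin _ (funeneg_ge0 (EFin \o f)) (summable_funeneg sumf).
rewrite (esum_sigma finK bije (funepos_ge0 (EFin \o f))).
rewrite (esum_sigma finK bije (funeneg_ge0 (EFin \o f))).
rewrite big_seq [X in (_ - X)%E]big_seq [RHS]big_seq.
rewrite fineB; [|by apply/sum_fin_numP => i _; auto..].
rewrite -!sum_fine// -sumrB; apply: eq_bigr => i iK.
rewrite -fineB; [|exact: finp|exact: finn].
by congr (fine (_ - _)%E); apply: eq_esum => j _; rewrite ?funeposE ?funenegE.
Qed.

(** * Convergence: the bound on T_k(n) *)

(* The term [2 * c / maxn n N] is a telescoping majorant of the missing tail. *)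
Lemma sum_inv_sqr_le (R : realType) (c : R) (n N : nat) : 0 <= c -> (0 < n)%N ->
  \sum_(0 <= x < N | (n <= x)%N) c / x%:R ^+ 2 + 2 * c / (maxn n N)%:R
    <= 2 * c / n%:R.
Proof.
move=> c0 n0; elim: N => [|N IH].
  by rewrite big_geq// add0r maxn0.
apply: le_trans IH; rewrite big_mkcond big_nat_recr//= -big_mkcond/=.
rewrite -addrA lerD2l; case: ifPn => nN; last first.
  rewrite -ltnNge in nN; by rewrite add0r (maxn_idPl nN) (maxn_idPl (ltnW nN)).
rewrite (maxn_idPr nN) (maxn_idPr (leqW nN)).
have N0 : (0 : R) < N%:R by rewrite ltr0n (leq_trans n0).
have N1 : (1 : R) <= N%:R by rewrite ler1n (leq_trans n0).
rewrite -subr_ge0 -[N.+1%:R]natr1.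
have -> : 2 * c / N%:R - (c / N%:R ^+ 2 + 2 * c / (N%:R + 1)) =
  c * (N%:R - 1) / (N%:R ^+ 2 * (N%:R + 1)) :> R.
  by field; rewrite ?gt_eqF//; lra.
by rewrite divr_ge0 ?mulr_ge0 ?exprn_ge0 ?subr_ge0//; lra.
Qed.

Lemma esum_inv_sqr_le (R : realType) (c : R) (n : nat) : 0 <= c -> (0 < n)%N ->
  (\esum_(x in [set x | (n <= x)%N]) (c / x%:R ^+ 2)%:E <= (2 * c / n%:R)%:E)%E.
Proof.
move=> c0 n0.
have f0 x : (n <= x)%N -> (0 <= (c / x%:R ^+ 2 : R)%:E)%E.
  by move=> _; rewrite lee_fin divr_ge0 ?exprn_ge0.
rewrite -(nneseries_esum f0).
apply: (lime_le (is_cvg_nneseries_cond (fun x _ => f0 x))).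
apply: nearW => N; rewrite sumEFin lee_fin.
by apply: le_trans (sum_inv_sqr_le N c0 n0); rewrite lerDl divr_ge0 ?mulr_ge0.
Qed.

(** The index set of T_k(n); for n = 1 it is [noninc_indices k] up to conversion. *)
Definition noninc_above (k n : nat) : set (seq nat) :=
  [set l | [/\ size l = k, sorted geq l & all (leq n) l]].

(** The last entry x bounds all the others from below and so becomes the new n. Passing from
    [sorted] to [pairwise] compares x with all of them at once. *)
Lemma rcons_noninc_above_bij (k n : nat) :
  set_bij ([set x | (n <= x)%N] `*`` noninc_above k) (noninc_above k.+1 n)
    (fun u => rcons u.2 u.1).
Proof.
split.
- move=> [x l] [/= nx [sl gl xl]]; split; first by rewrite size_rcons sl.
    rewrite (sorted_pairwise geq_trans) pairwise_rcons.
    by rewrite -(sorted_pairwise geq_trans) gl andbT.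
  rewrite all_rcons nx /=; apply: sub_all xl => y; exact: leq_trans.
- by move=> [x l] [y m] _ _ /= /rcons_inj [-> ->].
- move=> l [sl]; case/lastP: l sl => // l x; rewrite size_rcons => -[sl].
  rewrite (sorted_pairwise geq_trans) pairwise_rcons.
  rewrite -(sorted_pairwise geq_trans) all_rcons.
  by move=> /andP[xl gl] /andP[nx _]; exists (x, l).
Qed.

(* [head n l] squares the first entry, and for [l = [::]] makes the sum 1 / n,
   so that the recursion T_k(n) = sum_(x >= n) T_(k-1)(x) / x starts at k = 1. *)
Lemma esum_noninc_above_le (R : realType) (c : R) (k n : nat) :
  0 <= c -> (0 < n)%N ->
  (\esum_(l in noninc_above k n)
      (c / ((\prod_(x <- l) x%:R) * (head n l)%:R))%:E
    <= (2 ^+ k * c / n%:R)%:E)%E.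
Proof.
elim: k n c => [|k IH] n c c0 n0.
  rewrite (_ : noninc_above 0 n = [set [::]]); last first.
    by apply/seteqP; split=> [l []/size0nil|l ->].
  by rewrite esum_set1 ?lee_fin big_nil !mul1r ?divr_ge0.
rewrite (reindex_esum _ _ _ _ (rcons_noninc_above_bij k n)).
(* The last entry x is absorbed into the constant, c becoming c / x. As [head n (rcons l x)] is
   [head x l], the inner sum has the form of the induction hypothesis, with x for n. *)
pose a x l : \bar R := (c / x%:R / ((\prod_(y <- l) y%:R) * (head x l)%:R))%:E.
rewrite (eq_esum (b := fun u => a u.1 u.2)); last first.
  move=> [x l] _; rewrite /a /=; congr EFin.
  rewrite big_rcons/= headI /= -mulrA -invfM.
  by congr (_ / _); rewrite mulrA; congr (_ * _); rewrite mulrC.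
rewrite -esum_esum; last first.
  by move=> x l _ _; rewrite lee_fin !(divr_ge0, mulr_ge0, prodr_ge0).
apply: (@le_trans _ _
  (\esum_(x in [set x | (n <= x)%N]) (2 ^+ k * c / x%:R ^+ 2)%:E)%E).
  apply: le_esum => x /= nx; apply: le_trans (IH x _ _ _) _.
  - by rewrite divr_ge0.
  - exact: leq_trans nx.
  - by rewrite lee_fin expr2 invfM !mulrA.
apply: le_trans (esum_inv_sqr_le _ n0) _; first by rewrite mulr_ge0 ?exprn_ge0.
by rewrite exprS !mulrA.
Qed.

(** * Finiteness of the set of compositions *)

Lemma finite_compositions (k : nat) : finite_set (compositions k).
Proof.
pose B n := [set p : seq nat | (size p <= n)%N /\ all (leq^~ k) p].
have fB n : finite_set (B n).
  elim: n => [|n IH].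
    apply: (sub_finite_set (B := [set [::]])); last exact: finite_set1.
    by move=> p [/=]; rewrite leqn0 size_eq0 => /eqP.
  apply: (sub_finite_set (B := [set [::]] `|`
    [set u.1 :: u.2 | u in [set x | (x < k.+1)%N] `*` B n])).
    move=> [|x p] [/= sp]; first by left.
    by move=> /andP[xk ap]; right; exists (x, p).
  rewrite finite_setU; split; first exact: finite_set1.
  by apply: finite_image; apply: finite_setX => //; exact: finite_II.
(* The parts of a composition are positive, so there are at most k of them, each at most k. *)
apply: sub_finite_set (fB k) => p [p0 sp]; rewrite /B /= -{fB B}sp.
elim: p p0 => //= x p IH.
move=> /andP[x0 /IH[sp ap]]; split; first by rewrite -add1n leq_add.
rewrite leq_addr /=; apply: sub_all ap => y /leq_trans; apply; exact: leq_addl.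
Qed.

(** * The exponents sigma_j on nonincreasing tuples *)

Lemma sigma_cons (j x y : nat) (l : seq nat) :
  sigma j [:: x, y & l] = ((x == j) && (y == j) + sigma j (y :: l))%N.
Proof.
rewrite /sigma -!sum1_card /= !big_mkcond /= big_ord_recl /= !inE /=.
congr (_ + _)%N; rewrite [RHS]big_mkcond /=.
by apply: eq_bigr => r _; rewrite !inE.
Qed.

(** Equal entries of a nonincreasing tuple form one run, and a run of c entries has c - 1 adjacent
    pairs. For j absent both sides are 0, as [0.-1] is 0. *)
Lemma sigma_noninc (j : nat) (l : seq nat) :
  sorted geq l -> sigma j l = (count_mem j l).-1.
Proof.
elim: l => [|x [|y l] IH] gl.
- by rewrite /sigma -sum1_card /= big_ord0.
- by rewrite /sigma -sum1_card /= big_ord0; case: eqP.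
have /IH {}IH : sorted geq (y :: l) by case/andP: gl.
rewrite sigma_cons IH /=.
case: (eqVneq x j) => [xj|_] //=; case: (eqVneq y j) => //= yj.
(* Here x = j and y < j, so no later entry can equal j. *)
suff -> : count_mem j l = 0%N by [].
apply/count_memPn/negP => jl.
move: gl; rewrite /= (path_sortedE geq_trans).
move=> /andP[yx /andP[/allP/(_ _ jl) jy _]].
move: yx jy yj; rewrite /= xj => yj jy /eqP; apply.
by apply/eqP; rewrite eqn_leq yj.
Qed.

(** Values j absent from l have exponent 0 and contribute 1, even if t j = 0, so only the distinct
    entries of l remain. *)
Lemma prod_sigmaE (R : realType) (t : nat -> R) (l : seq nat) :
  sorted geq l -> all (leq 1) l ->
  \big[*%R/1]_(j \in [set j | (1 <= j)%N]) t j ^+ sigma j l =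
  \prod_(j <- undup l) t j ^+ (count_mem j l).-1.
Proof.
move=> gl l1; rewrite (fsbigE (undup l)) ?undup_uniq//.
- rewrite [LHS]big_seq_cond [RHS]big_seq; apply: eq_big => [j|j _].
    rewrite mem_undup; case jl: (j \in l) => //=.
    exact/mem_set/(allP l1).
  by rewrite sigma_noninc.
- by move=> j /=; rewrite mem_undup; exact: (allP l1).
- by move=> j _; rewrite mem_undup => /count_memPn; rewrite sigma_noninc// => ->.
Qed.

(** * Tuples as values with multiplicities *)

Lemma mem_tally_seq (bs : seq (nat * nat)) x :
  x \in tally_seq bs -> x \in unzip1 bs.
Proof.
move=> /flattenP[s /mapP[[y n] ybs ->]] /nseqP[-> _].
by apply/mapP; exists (y, n).
Qed.

Lemma sorted_tally_seq (bs : seq (nat * nat)) :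
  sorted gtn (unzip1 bs) -> sorted geq (tally_seq bs).
Proof.
have gtn_trans : transitive gtn by move=> a b c /= ba cb; exact: ltn_trans cb ba.
elim: bs => [|[x n] bs IH] //=; rewrite (path_sortedE gtn_trans) => /andP[xm gm].
rewrite (sorted_pairwise geq_trans) pairwise_cat -!(sorted_pairwise geq_trans).
rewrite (IH gm) andbT; apply/andP; split.
  apply/allrelP => y z /nseqP[-> _] /mem_tally_seq zbs.
  exact/ltnW/(allP xm).
rewrite (sorted_pairwise geq_trans); elim: n => //= n ->.
by rewrite all_nseq /= leqnn orbT.
Qed.

(** On well-formed lists [tally] inverts [tally_seq], and a tally pairs each value with its
    count. *)
Lemma count_mem_tally_seq (bs : seq (nat * nat)) (b : nat * nat) :
  bs \is a wf_tally _ -> b \in bs -> count_mem b.1 (tally_seq bs) = b.2.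
Proof.
move=> wf; rewrite -{1}(tally_seqK wf) (perm_mem (tallyE _)).
by case: b => x n /mapP[y _ [-> ->]].
Qed.

Lemma undup_tally_seq (bs : seq (nat * nat)) :
  bs \is a wf_tally _ -> sorted gtn (unzip1 bs) -> undup (tally_seq bs) = unzip1 bs.
Proof.
move=> wf gbs; apply: (@sorted_eq _ geq geq_trans).
- exact: anti_geq.
- exact/(subseq_sorted geq_trans (undup_subseq _))/sorted_tally_seq.
- by apply: sub_sorted gbs => x y /ltnW.
- by rewrite -{2}[bs](tally_seqK wf) perm_sym tallyEl.
Qed.

Lemma wf_tally_zip (m p : seq nat) :
  size m = size p -> sorted gtn m -> all (leq 1) p -> zip m p \is a wf_tally _.
Proof.
move=> sz gm p0; apply/andP; rewrite unzip1_zip ?sz// unzip2_zip ?sz//; split.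
  by move: gm; rewrite gtn_sorted_uniq_geq => /andP[].
by apply/negP => /(allP p0).
Qed.

(** The pair (p, m) goes to the tuple in which m_s is repeated p_s times. Injectivity holds because
    [tally] recovers [zip m p]. *)
Lemma tally_seq_bij (k : nat) :
  set_bij (compositions k `*`` (fun p => dec_indices (size p)))
    (noninc_indices k) (fun u => tally_seq (zip u.2 u.1)).
Proof.
split.
- move=> [p m] [/= [p0 sp] [sm gm m0]]; split.
  + by rewrite size_tally_seq unzip2_zip ?sm.
  + by apply: sorted_tally_seq; rewrite unzip1_zip ?sm.
  + apply/allP => x /mem_tally_seq; rewrite unzip1_zip ?sm//; exact: (allP m0).
- move=> [p m] [q n] /set_mem[/= [p0 _] [sm gm _]].
  move=> /set_mem[/= [q0 _] [sn gn _]] /(congr1 (@tally _)) /=.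
  rewrite !tally_seqK ?wf_tally_zip// => ez.
  have := congr1 unzip1 ez; rewrite !unzip1_zip ?sm ?sn// => ->.
  by have := congr1 unzip2 ez; rewrite !unzip2_zip ?sm ?sn// => ->.
- move=> l [sl gl l0].
  have gul : sorted gtn (undup l).
    rewrite gtn_sorted_uniq_geq undup_uniq.
    by rewrite (subseq_sorted geq_trans (undup_subseq _)).
  (* The preimage of l: its distinct values, already in decreasing order, with their counts. *)
  exists ([seq count_mem x l | x <- undup l], undup l).
    split; [split|split] => /=.
    + by apply/allP => _ /mapP[x xl ->]; rewrite -has_count has_pred1 -mem_undup.
    + rewrite -sl -(perm_size (tallyK l)) size_tally_seq.
      rewrite (perm_sumn (perm_map _ (tallyE l))) -map_comp; congr sumn.
    + by rewrite size_map.
    + exact: gul.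
    + by apply/allP => x; rewrite mem_undup; exact: (allP l0).
  (* Both tuples are nonincreasing, so it is enough that they are permutations of each other. *)
  rewrite /= -{1}[undup l]map_id zip_map.
  apply: (@sorted_eq _ geq geq_trans) => //.
  + exact: anti_geq.
  + apply: sorted_tally_seq; rewrite /unzip1 -map_comp map_id_in //.
  + apply: perm_trans (tallyK l); rewrite perm_sym; apply: perm_tally_seq.
    exact: tallyE.
Qed.

(** * Comparison and domination of the summands *)

Lemma prod_zip (R : comPzSemiRingType) (T : Type) (y0 : T) (f : nat -> T -> R)
    (l : seq nat) (s : seq T) : size l = size s ->
  \prod_(b <- zip l s) f b.1 b.2 = \prod_(r < size s) f (nth 0%N l r) (nth y0 s r).
Proof.
move=> sl; rewrite (big_nth (0%N, y0)) big_mkord size_zip sl minnn.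
by apply: eq_bigr => r _; rewrite nth_zip.
Qed.

(** Removing the first part n lowers every later partial sum P_s by n, which amounts to dropping the
    first n exponents. *)
Lemma merged_cons (i p : seq nat) (n : nat) :
  merged i (n :: p) =
  (n.-1, (\sum_(0 <= j < n) nth 0 i j)%N) :: merged (drop n i) p.
Proof.
rewrite /merged /mkseq /= /psum /= take0 /= addn0; congr (_ :: _).
rewrite -[1%N]addn0 iotaDl -map_comp; apply: eq_map => s /=; congr (_, _).
rewrite ![(n + _)%N]addnC big_addn addnK.
by apply: eq_bigr => j _; rewrite nth_drop addnC.
Qed.

(** A run of n copies of x meets n consecutive exponents, and the product of these powers of x is x
    to the sum of the exponents. *)
Lemma prod_tally_seq (R : comPzSemiRingType) (m p i : seq nat) :
  size m = size p -> sumn p = size i ->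
  \prod_(b <- zip (tally_seq (zip m p)) i) (b.1%:R ^+ b.2 : R) =
  \prod_(b <- zip m (merged i p)) b.1%:R ^+ b.2.2.
Proof.
elim: p m i => [|n p IH] [|x m] i //; first by case: i => // _ _; rewrite !big_nil.
move=> [sz] si.
rewrite merged_cons /= big_cons /=.
rewrite -{1}(cat_take_drop n i) zip_cat; last first.
  by rewrite size_nseq size_takel// -si leq_addr.
rewrite big_cat IH//; last by rewrite size_drop -si addKn.
congr (_ * _); have sn : size (take n i) = n by rewrite size_takel// -si leq_addr.
rewrite (prod_zip 0%N (fun x e => x%:R ^+ e)) ?size_nseq ?sn// big_mkord.
rewrite -prodrXr; apply: eq_bigr => j _; rewrite nth_nseq ltn_ord nth_take//.
Qed.

(** Convertible to the summand of [interpolated_mzv], as [mzv_var_term] is to that of [mzv_var]. *)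
Definition interpolated_term (R : realType) (t : nat -> R) (i l : seq nat) : R :=
  (\big[*%R/1]_(j \in [set j : nat | (1 <= j)%N]) t j ^+ sigma j l)
  / \prod_(r < size i) (nth 0%N l r)%:R ^+ nth 0%N i r.

Definition mzv_var_term (R : realType) (t : nat -> R) (a : seq (nat * nat))
    (l : seq nat) : R :=
  (\prod_(r < size a) t (nth 0%N l r) ^+ (nth (0%N, 0%N) a r).1)
  / \prod_(r < size a) (nth 0%N l r)%:R ^+ (nth (0%N, 0%N) a r).2.

(** The denominators agree by merging exponents run by run; in the numerators the exponent of t at
    m_s is p_s - 1 on both sides. *)
Lemma interpolated_term_tally_seq (R : realType) (t : nat -> R) (i p m : seq nat) :
  compositions (size i) p -> dec_indices (size p) m ->
  interpolated_term t i (tally_seq (zip m p)) = mzv_var_term t (merged i p) m.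
Proof.
move=> [p0 sp] [sm gm m0].
have sa : size (merged i p) = size p by rewrite size_mkseq.
have st : size (tally_seq (zip m p)) = size i.
  by rewrite size_tally_seq unzip2_zip ?sm.
have um : unzip1 (zip m p) = m by rewrite unzip1_zip ?sm.
have gz : sorted gtn (unzip1 (zip m p)) by rewrite um.
have wf := wf_tally_zip sm gm p0.
congr (_ / _); last first.
  rewrite -(prod_zip 0%N (fun x e => x%:R ^+ e))// prod_tally_seq//.
  by rewrite -(prod_zip (0, 0)%N (fun x b => x%:R ^+ b.2)) ?sa.
rewrite prod_sigmaE ?sorted_tally_seq//; last first.
  by apply/allP => x /mem_tally_seq; rewrite um; exact: (allP m0).
rewrite undup_tally_seq// /unzip1 big_map big_seq.
under eq_bigr => b bz do rewrite (count_mem_tally_seq wf bz).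
rewrite -big_seq (prod_zip 0%N (fun x n => t x ^+ n.-1))// sa.
by apply: eq_bigr => r _; rewrite nth_mkseq.
Qed.

(** The numerator is at most 1 in absolute value because |t_j| <= 1. The first exponent is at least
    2 and the others at least 1, so the denominator is at least l_1^2 l_2 ... l_k. *)
Lemma normr_interpolated_term_le (R : realType) (t : nat -> R) (i l : seq nat) :
  (forall j, (1 <= j)%N -> -1 <= t j <= 1) ->
  (1 < nth 0 i 0)%N -> (forall j, (j < size i)%N -> (1 <= nth 0 i j)%N) ->
  noninc_indices (size i) l ->
  `|interpolated_term t i l| <= ((\prod_(x <- l) x%:R) * (head 1 l)%:R)^-1.
Proof.
move=> ht; case: i => // a i /= a1 i1 [].
case: l => // x l [sl] gl l0.
have den : \prod_(r < size (a :: i)) (nth 0%N (x :: l) r)%:R ^+ nth 0%N (a :: i) r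
    >= (\prod_(y <- x :: l) y%:R) * x%:R :> R.
  rewrite big_cons mulrAC -expr2 big_ord_recl ler_pM ?exprn_ge0 ?prodr_ge0//.
    by rewrite ler_weXn2l// ler1n; case/andP: l0.
  rewrite (big_nth 0%N) big_mkord sl; apply: ler_prod => r _ /=.
  rewrite ler0n /= -{1}[(nth 0%N l r)%:R]expr1 ler_weXn2l//.
    by rewrite ler1n; apply: (allP l0); rewrite in_cons mem_nth ?orbT// sl.
  exact: (i1 r.+1 (ltn_ord r)).
have low0 : 0 < (\prod_(y <- x :: l) y%:R) * x%:R :> R.
  rewrite mulr_gt0//; last by rewrite ltr0n; case/andP: l0.
  by rewrite big_seq prodr_gt0// => y /(allP l0); rewrite ltr0n.
rewrite /interpolated_term normrM normfV -[leRHS]mul1r ler_pM//.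
  rewrite prod_sigmaE// normr_prod big_seq.
  apply: prodr_ile1 => j; rewrite mem_undup => /(allP l0) j0.
  by rewrite normr_ge0 normrX exprn_ile1// ler_norml ht.
rewrite ger0_norm ?(le_trans (ltW low0) den)// lef_pV2 ?posrE//.
exact: lt_le_trans low0 den.
Qed.

Theorem theorem1 (R : realType) (t : nat -> R)
  (ht : forall j : nat, (1 <= j)%N -> (-1 <= t j <= 1)%R)
  (k : nat) (hk : (1 <= k)%N) (i : k.-tuple nat)
  (hi : forall j : nat, (j < k)%N -> (1 <= nth 0%N i j)%N)
  (hi1 : (1 < nth 0%N i 0)%N) :
  interpolated_mzv t i =
  (\sum_(p \in compositions k) mzv_var t (merged i p))%R.
Proof.
rewrite -[k in compositions k](size_tuple i).
rewrite [LHS](rsum_sigma (finite_compositions _) (tally_seq_bij _)); last first.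
  (* Absolute summability: the terms are dominated by those of T_k(1), whose bound is used with c =
     n = 1. *)
  apply: (@le_lt_trans _ _ (2 ^+ size i * 1 / 1)%:E); last exact: ltry.
  apply: le_trans (esum_noninc_above_le (size i) ler01 (ltnSn 0)).
  apply: le_esum => l Dl; rewrite /= lee_fin mul1r.
  by apply: normr_interpolated_term_le => //; rewrite size_tuple.
apply: eq_fsbigr => p /set_mem Kp.
rewrite /mzv_var size_mkseq; apply: eq_rsum => m Dm.
by have := interpolated_term_tally_seq t Kp Dm; rewrite /mzv_var_term size_mkseq.
Qed.
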